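(* Let $\mathbb{F}_q$ be a finite field with $q$ elements of odd characteristic, let $j\in\mathbb{F}_q$, and let $\mathbb{S}^2_j=\{\boldsymbol{\xi}\in\mathbb{F}_q^3:\xi_1^2+\xi_2^2+\xi_3^2=j\}$, equipped with its normalized counting measure $\sigma$. Suppose that $-j\neq 0$ and that $-j$ is not a square in $\mathbb{F}_q^\times$. Then for every function $f:\mathbb{S}^2_j\to\mathbb{C}$, $$\|(f\sigma)^{\vee}\|^4_{L^4(\mathbb{F}_q^3,d\boldsymbol{x})}\leq \frac{q^3}{|\mathbb{S}^2_j|^2}\left(q+1-\frac{3q}{|\mathbb{S}^2_j|}\right)\|f\|^4_{L^2(\mathbb{S}^2_j,d\sigma)}.$$ This inequality is sharp (the constant on the right-hand side cannot be replaced by a smaller one), and equality holds if $f$ is a constant function. Moreover, any maximizer $f$ of this inequality has constant modulus, i.e. $|f|$ is constant on $\mathbb{S}^2_j$.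
   Context: Fix a non-principal (nontrivial) additive character $\chi:\mathbb{F}_q\to\{z\in\mathbb{C}:|z|=1\}$. For a nonempty finite set $\mathcal{S}\subset\mathbb{F}_q^3$ and $f:\mathcal{S}\to\mathbb{C}$, define for $\boldsymbol{x}\in\mathbb{F}_q^3$ $$(f\sigma)^\vee(\boldsymbol{x})=\frac{1}{|\mathcal{S}|}\sum_{\boldsymbol{\xi}\in\mathcal{S}}f(\boldsymbol{\xi})\chi(\boldsymbol{\xi}\cdot\boldsymbol{x}),\qquad \boldsymbol{\xi}\cdot\boldsymbol{x}=\xi_1x_1+\xi_2x_2+\xi_3x_3.$$ Norms: $d\boldsymbol{x}$ is counting measure, so $\|g\|_{L^4(\mathbb{F}_q^3,d\boldsymbol{x})}^4=\sum_{\boldsymbol{x}\in\mathbb{F}_q^3}|g(\boldsymbol{x})|^4$; $\sigma$ is normalized counting measure on $\mathcal{S}$, so $\|f\|_{L^2(\mathcal{S},d\sigma)}^2=\frac{1}{|\mathcal{S}|}\sum_{\boldsymbol{\xi}\in\mathcal{S}}|f(\boldsymbol{\xi})|^2$. $|\cdot|$ of a set denotes cardinality, and $\mathbb{F}_q^\times=\mathbb{F}_q\setminus\{0\}$. A maximizer is a nonzero function $f$ for which equality holds. *)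

(* Defs.v *)
From mathcomp Require Import all_boot all_order all_algebra complex.
From mathcomp Require Import reals exp.
Set Implicit Arguments.
Unset Strict Implicit.
Unset Printing Implicit Defensive.
Import Order.TTheory GRing.Theory Num.Theory.
Local Open Scope ring_scope.
Local Open Scope complex_scope.

(* The modulus is [Normc.normc : R[i] -> R], the real-valued version of
   the norm [`|z|], which lives in [R[i]]. *)
Notation modulus := Normc.normc.

Definition nonprincipal_additive_character (R : realType) (F : finFieldType)
    (chi : F -> R[i]) : Prop :=
  [/\ forall x y, chi (x + y) = chi x * chi y,
      forall x, modulus (chi x) = 1
    & exists x, chi x != 1].

Definition dot (F : finFieldType) (xi x : 'rV[F]_3) : F :=
  \sum_(i < 3) xi 0 i * x 0 i.

Definition sphere (F : finFieldType) (j : F) : {set 'rV[F]_3} :=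
  [set xi : 'rV[F]_3 | \sum_(i < 3) xi 0 i ^+ 2 == j].

(* Functions on S are functions on the finite subtype of points of S. *)
Notation points S := {xi : 'rV_3 | xi \in S}.

(* (f sigma)^\vee, with sigma the normalized counting measure on S *)
Definition extension (R : realType) (F : finFieldType) (chi : F -> R[i])
    (S : {set 'rV[F]_3}) (f : points S -> R[i]) (x : 'rV[F]_3) : R[i] :=
  #|S|%:R^-1 * \sum_(xi : points S) f xi * chi (dot (val xi) x).

(* L^4 norm on F^3 with respect to counting measure *)
Definition L4norm (R : realType) (F : finFieldType) (g : 'rV[F]_3 -> R[i]) : R :=
  (\sum_(x : 'rV[F]_3) modulus (g x) ^+ 4) `^ 4^-1.

(* L^2 norm on S with respect to normalized counting measure *)
Definition L2norm (R : realType) (F : finFieldType) (S : {set 'rV[F]_3})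
    (f : points S -> R[i]) : R :=
  Num.sqrt (#|S|%:R^-1 * \sum_(xi : points S) modulus (f xi) ^+ 2).

(* Main.v *)
Require Import Defs.
From mathcomp Require Import all_boot all_order all_algebra complex.
From mathcomp Require Import reals exp.
From mathcomp Require Import zify ring lra.
Set Implicit Arguments.
Unset Strict Implicit.
Unset Printing Implicit Defensive.
Import Order.TTheory GRing.Theory Num.Theory.
Local Open Scope ring_scope.
Local Open Scope complex_scope.

(* By Parseval the L^4 norm of the extension of f is, up to normalization, the
   additive energy sum_s |sum_(x + y = s) f x f y|^2.  Write u = |f|^2, W for its
   sum, r s for the number of representations of s as a sum of two points of the
   sphere S, and n s for the number of isotropic lines orthogonal to s.  The plane
   section of S with sum s is a conic with n s points at infinity, so
   r s = q + 1 - n s, except that r (2 x) = 1.  Cauchy-Schwarz for each s <> 0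
   bounds the energy by
     (sum_x |f x f (- x)|)^2 + (q + 1) W^2 - B(u) - q sum_x u x ^ 2,
     B(u) = sum_(x, y) n (x + y) u x u y.
   Split u = w + v into even and odd parts.  As - j is not a square, no isotropic
   line is orthogonal to a point of S; grouping the points of S by their pairing
   with each isotropic line gives B(w) >= (q + 1) / (q - 1) W^2.  Since v has mean
   zero and |n - 1| <= 1 off the antipodal pairs,
     B(v) >= sum v^2 - (sum |v|)^2 - q sum v^2,
   and (sum |v|)^2 is absorbed by
     (sum_x |f x f (- x)|)^2 + (sum |v|)^2 <= W^2.
   Altogether the energy is at most (q + 1 - 3 / (q - 1)) W^2, with deficit at
   least sum v^2 + q sum_S (w - W / |S|)^2, which forces |f| to be constant for
   a maximizer. *)

(** * Values of binary quadratic forms over a finite field *)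

Section BinaryForms.
Variable F : finFieldType.
Hypothesis two_neq0 : 2 != 0 :> F.

Lemma card_sqrts_le2 (a : F) : (#|[set x : F | x ^+ 2 == a]| <= 2)%N.
Proof.
have [->|/set0Pn[x]] := eqVneq [set x : F | x ^+ 2 == a] set0; first by rewrite cards0.
rewrite inE => /eqP <-; apply: (@leq_trans #|[set x; - x]|); last first.
  by rewrite cards2; case: (_ == _).
by apply/subset_leq_card/subsetP => y; rewrite !inE eqf_sqr.
Qed.

(** Squaring is at most two-to-one, and 0 has a single root. *)
Lemma card_squares : (#|F| < 2 * #|[set x ^+ 2 | x : F]|)%N.
Proof.
set A := [set x ^+ 2 | x : F].
have A0 : 0 \in A by apply/imsetP; exists 0; rewrite ?expr0n.
have -> : #|F| = (\sum_(a in A) #|[set x : F | x ^+ 2 == a]|)%N.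
  rewrite -cardsT -sum1_card (partition_big (fun x : F => x ^+ 2) (mem A)) /=; last first.
    by move=> x _; apply/imsetP; exists x.
  apply: eq_bigr => a _; rewrite -sum1_card.
  by apply: eq_bigl => x; rewrite !inE.
rewrite (bigD1 0) //= (_ : [set x : F | x ^+ 2 == 0] = [set 0]); last first.
  by apply/setP=> x; rewrite !inE sqrf_eq0.
rewrite cards1 (cardsD1 0 A) A0 mulnDr muln1 add2n !ltnS.
rewrite -sum1_card big_distrr /=.
rewrite (eq_bigl (fun a => a \in A :\ 0)); last by move=> a; rewrite !inE andbC.
by apply: leq_sum => a _; rewrite muln1 card_sqrts_le2.
Qed.

(** Pigeonhole: the squares and the elements [k - D * a] with [a] a square each fill more than half
    of [F], so they meet. *)
Lemma binary_form_universal (D k : F) :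
  D != 0 -> exists x y : F, x ^+ 2 + D * y ^+ 2 = k.
Proof.
move=> D0; pose A : {set F} := [set x ^+ 2 | x : F].
pose B : {set F} := [set k - D * a | a in A].
have cB : #|B| = #|A|.
  by rewrite card_in_imset // => a b _ _ /addrI/oppr_inj/(mulfI D0).
have: ~~ [disjoint A & B].
  rewrite -setI_eq0 -cards_eq0 -lt0n.
  have : (#|A :|: B| <= #|F|)%N := max_card _.
  have : (#|F| < 2 * #|A|)%N := card_squares.
  by have := cardsUI A B; rewrite cB; lia.
case/pred0Pn => _ /andP[/imsetP[x _ ->] /imsetP[_ /imsetP[y _ ->]]] xy.
by exists x, y; rewrite xy subrK.
Qed.

(** The form is multiplicative, so it takes all nonzero values equally often; counting the zeros and
    then all pairs gives the common frequency. *)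
Lemma card_conic (D k : F) : D != 0 -> k != 0 ->
  (#|[set z : F * F | z.1 ^+ 2 + D * z.2 ^+ 2 == k]%R| +
   #|[set z : F | z ^+ 2 == - D]%R| = #|F|.+1)%N.
Proof.
move=> D0 k0.
pose N (l : F) := #|[set z : F * F | z.1 ^+ 2 + D * z.2 ^+ 2 == l]|.
set n := #|[set z : F | z ^+ 2 == - D]|.
have leN (l m : F) : l != 0 -> m != 0 -> (N l <= N m)%N.
  move=> l0 m0; have [a [b ab]] := binary_form_universal (m / l) D0.
  (* Multiplication by a + b sqrt(- D), which scales the form by [a ^+ 2 + D * b ^+ 2 = m / l]. *)
  pose g (z : F * F) := (a * z.1 - D * b * z.2, a * z.2 + b * z.1).
  have nab : m / l != 0 by rewrite mulf_neq0 ?invr_eq0.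
  rewrite /N -(card_in_imset (f := g)); last first.
    move=> [x y] [x' y'] _ _ [e1 e2].
    have ex : (m / l) * x = (m / l) * x'.
      rewrite -ab; transitivity (a * (a * x - D * b * y) + D * b * (a * y + b * x)).
        by ring.
      by rewrite e1 e2; ring.
    have ey : (m / l) * y = (m / l) * y'.
      rewrite -ab; transitivity (a * (a * y + b * x) - b * (a * x - D * b * y)).
        by ring.
      by rewrite e1 e2; ring.
    by rewrite (mulfI nab ex) (mulfI nab ey).
  apply/subset_leq_card/subsetP => w /imsetP[[x y]]; rewrite inE /= => /eqP xy ->.
  rewrite inE /=; apply/eqP.
  transitivity ((a ^+ 2 + D * b ^+ 2) * (x ^+ 2 + D * y ^+ 2)); first by ring.
  by rewrite ab xy divfK.
have eqN (l : F) : l != 0 -> N l = N k.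
  by move=> l0; apply/eqP; rewrite eqn_leq !leN.
have q0 : (0 < #|F|.-1)%N.
  by rewrite -subn1 subn_gt0 card_finNzRing_gt1.
have N0 : N 0 = (1 + #|F|.-1 * n)%N.
  have -> : (#|F|.-1 * n)%N = #|setX (~: [set 0 : F]) [set z : F | z ^+ 2 == - D]|.
    by rewrite cardsX cardsC1.
  (* A zero (x, y) other than the origin has y nonzero, so it is determined by y and the root x / y
     of [- D]. *)
  pose h (z : F * F) := (z.1 * z.2, z.1).
  rewrite /N (cardsD1 (0, 0)) inE /= !expr0n /= mulr0 addr0 eqxx; congr (_ + _)%N.
  rewrite -[RHS](card_in_imset (f := h)); last first.
    move=> [x y] [x' y']; rewrite !inE /= => /andP[x0 _] _ [+ xx]; rewrite -xx.
    by move=> /(mulfI x0) ->.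
  apply: eq_card => -[x y]; rewrite !inE /=; apply/idP/imsetP.
    case/andP=> xy0 /eqP xy.
    have y0 : y != 0.
      apply: contraNneq xy0 => y0; move: xy; rewrite y0 expr0n mulr0 addr0 => /eqP.
      by rewrite sqrf_eq0 => /eqP->.
    exists (y, x / y); last by rewrite /h /= mulrC divfK.
    rewrite !inE /= y0 /= expr_div_n; apply/eqP.
    have -> : x ^+ 2 = - D * y ^+ 2 by rewrite mulNr; apply/eqP; rewrite -addr_eq0 xy.
    by rewrite mulfK // expf_neq0.
  case=> [[y' z]]; rewrite !inE /= => /andP[+ /eqP zD] [-> ->].
  move=> y0; apply/andP; split; first by apply: contraNneq y0 => -[_ ->].
  by rewrite exprMn zD; apply/eqP; ring.
have tot : (#|F| * #|F| = N 0%R + #|F|.-1 * N k)%N.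
  rewrite -card_prod -cardsT -sum1_card.
  rewrite (partition_big (fun z : F * F => z.1 ^+ 2 + D * z.2 ^+ 2) xpredT) //=.
  rewrite (bigD1 0) //=; congr (_ + _)%N.
    by rewrite /N -sum1_card; apply: eq_bigl => z; rewrite !inE.
  rewrite -(cardC1 (0 : F)) -sum1_card big_distrl /=.
  apply: eq_big => [l|l l0]; first by rewrite !inE.
  by rewrite mul1n -(eqN _ l0) /N -sum1_card; apply: eq_bigl => z; rewrite !inE.
have qS : #|F| = #|F|.-1.+1 by rewrite prednK // ltnW // card_finNzRing_gt1.
move: tot; rewrite N0 qS -/(N k) => tot; apply/eqP; rewrite -(eqn_pmul2l q0).
clear N0; move: q0 tot => /=; move: #|F|.-1 (N k) n => m N1 n1 _ tot; apply/eqP.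
by rewrite mulSn mulnS in tot; nia.
Qed.
End BinaryForms.

(* The projective line option F indexes the isotropic lines; L c is the pairing
   with a generator of the c-th one. *)
Record ruled_sphere (F : finFieldType) (V : finZmodType)
    (S : {set V}) (L : option F -> V -> F) : Prop := RuledSphere {
  rs_odd : 2 != 0 :> F;
  rs_opp : forall x, x \in S -> - x \in S;
  rs_add : forall c x y, L c (x + y) = L c x + L c y;
  rs_neq0 : forall c x, x \in S -> L c x != 0;
  rs_fiber : forall c (a : F), a != 0 -> #|[set x in S | L c x == a]| = #|F|;
  rs_zeros : forall s, s != 0 -> (#|[set c | L c s == 0%R]| <= 2)%N;
  rs_double : forall x, x \in S -> #|[set z in S | x + x - z \in S]| = 1%N;
  rs_sum : forall x y, x \in S -> y \in S -> x != y -> x + y != 0 ->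
    (#|[set z in S | (x + y - z)%R \in S]| + #|[set c | L c (x + y)%R == 0%R]|
     = #|F|.+1)%N }.

(** * The quadric u v - t^2 = j and its isotropic lines *)

Section Coordinates.
Variables (F : finFieldType) (V : finZmodType) (j : F).
Variables (u v t : V -> F) (mk : F -> F -> F -> V).
Hypothesis two_neq0 : 2 != 0 :> F.
Hypothesis nonsquare : forall y : F, y ^+ 2 != - j.
Hypotheses (uD : {morph u : x y / x + y}) (vD : {morph v : x y / x + y})
  (tD : {morph t : x y / x + y}).
Hypothesis mkE : forall a b c, [/\ u (mk a b c) = a, v (mk a b c) = b & t (mk a b c) = c].
Hypothesis mkK : forall x, mk (u x) (v x) (t x) = x.

Let S := [set x | u x * v x - t x ^+ 2 == j].

(* Twice the values of the symmetric matrix (u, t; t, v) of determinant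
   u v - t^2 at the points (1 : c) and (0 : 1) of the projective line. *)
Definition ruling (c : option F) (x : V) : F :=
  if c is Some c then u x + 2 * c * t x + c ^+ 2 * v x else v x.

Let uN x : u (- x) = - u x.
Proof. by apply: (addrI (u x)); rewrite -uD !subrr; apply: (addIr (u 0)); rewrite -uD !add0r. Qed.
Let vN x : v (- x) = - v x.
Proof. by apply: (addrI (v x)); rewrite -vD !subrr; apply: (addIr (v 0)); rewrite -vD !add0r. Qed.
Let tN x : t (- x) = - t x.
Proof. by apply: (addrI (t x)); rewrite -tD !subrr; apply: (addIr (t 0)); rewrite -tD !add0r. Qed.

Lemma coords_inj x y : u x = u y -> v x = v y -> t x = t y -> x = y.
Proof. by move=> eu ev et; rewrite -(mkK x) -(mkK y) eu ev et. Qed.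

Lemma coords_eq0 x : u x = 0 -> v x = 0 -> t x = 0 -> x = 0.
Proof.
move=> u0 v0 t0; apply: coords_inj; rewrite ?u0 ?v0 ?t0.
- by apply: (addIr (u 0)); rewrite -uD !add0r.
- by apply: (addIr (v 0)); rewrite -vD !add0r.
- by apply: (addIr (t 0)); rewrite -tD !add0r.
Qed.

Lemma sphereP x : reflect (u x * v x = j + t x ^+ 2) (x \in S).
Proof. by rewrite inE subr_eq; apply: eqP. Qed.

Lemma sphere_v_neq0 x : x \in S -> v x != 0.
Proof.
move/sphereP=> e; apply: contraNneq (nonsquare (t x)) => v0.
by move: e; rewrite v0 mulr0 => /esym/eqP; rewrite addrC addr_eq0.
Qed.

(** Completing the square, [(t x + c * v x) ^+ 2] is [- j] plus a multiple of [ruling]; a zero would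
    make [- j] a square. *)
Lemma ruling_neq0 c x : x \in S -> ruling c x != 0.
Proof.
move=> xS; case: c => [c|] /=; last exact: sphere_v_neq0.
apply: contraNneq (nonsquare (t x + c * v x)) => r0.
have e := sphereP _ xS.
have -> : (t x + c * v x) ^+ 2 = - j + (u x + 2 * c * t x + c ^+ 2 * v x) * v x.
  transitivity (j + t x ^+ 2 - j + 2 * c * t x * v x + c ^+ 2 * v x ^+ 2); first by ring.
  by rewrite -e; ring.
by rewrite r0 mul0r addr0.
Qed.

(** The two equations say that [d] is isotropic and orthogonal to [x]. If [v d != 0], then [d] spans
    the line of index [- t d / v d], whose pairing with [x] cannot vanish. *)
Lemma isotropic_orthogonal_eq0 x d : x \in S -> u d * v d = t d ^+ 2 ->
  u x * v d + v x * u d = 2 * t x * t d -> d = 0.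
Proof.
move=> xS d0 xd.
have vd0 : v d = 0.
  apply/eqP; apply: contraT => vd0.
  have := ruling_neq0 (Some (- t d / v d)) xS; case/eqP => /=.
  have -> : u x + 2 * (- t d / v d) * t x + (- t d / v d) ^+ 2 * v x =
    (u x * v d + v x * (t d ^+ 2 / v d) - 2 * t x * t d) / v d by field.
  by rewrite -d0 mulfK // xd subrr mul0r.
have td0 : t d = 0.
  by apply/eqP; rewrite -sqrf_eq0 -d0 vd0 mulr0.
apply: coords_eq0 => //; apply/eqP; move/eqP: xd.
by rewrite vd0 td0 !mulr0 add0r mulf_eq0 (negPf (sphere_v_neq0 xS)).
Qed.

Lemma card_ruling_fiber c (a : F) :
  a != 0 -> #|[set x in S | ruling c x == a]| = #|F|.
Proof.
move=> a0; case: c => [c|].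
  (* On the fiber, [T = t x + c * v x] satisfies [T ^+ 2 + j = a * v x], so [T] is a free
     parameter. *)
  pose w (T : F) := (T ^+ 2 + j) / a.
  pose g T := mk (a - 2 * c * (T - c * w T) - c ^+ 2 * w T) (w T) (T - c * w T).
  have -> : [set x in S | ruling (Some c) x == a] = [set g T | T : F].
    apply/setP=> x; rewrite inE; apply/andP/imsetP => [[xS /eqP /= e]|[T _ ->]].
      exists (t x + c * v x) => //.
      have wE : w (t x + c * v x) = v x.
        rewrite /w; apply: (mulIf a0); rewrite divfK // -e.
        by have e1 := sphereP _ xS; ring: e1.
      rewrite /g wE -[LHS]mkK; congr (mk _ _ _); last by ring.
      by rewrite -e; ring.
    have [gu gv gt] := mkE (a - 2 * c * (T - c * w T) - c ^+ 2 * w T) (w T) (T - c * w T).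
    split; last by rewrite /= gu gv gt; apply/eqP; ring.
    by apply/sphereP; rewrite gu gv gt /w; field.
  rewrite card_imset // => T T' /(congr1 (fun x => t x + c * v x)).
  rewrite /g; have [_ -> ->] := mkE (a - 2 * c * (T - c * w T) - c ^+ 2 * w T) (w T) (T - c * w T).
  have [_ -> ->] := mkE (a - 2 * c * (T' - c * w T') - c ^+ 2 * w T') (w T') (T' - c * w T').
  by rewrite !subrK.
pose g T := mk ((j + T ^+ 2) / a) a T.
have -> : [set x in S | ruling None x == a] = [set g T | T : F].
  apply/setP=> x; rewrite inE; apply/andP/imsetP => [[xS /eqP /= e]|[T _ ->]].
    exists (t x) => //; rewrite /g -(sphereP _ xS) -e mulfK ?mkK //.
    by rewrite e.
  have [gu gv gt] := mkE ((j + T ^+ 2) / a) a T.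
  split; last by rewrite /= gv.
  by apply/sphereP; rewrite gu gv gt divfK.
rewrite card_imset // => T T' /(congr1 t); rewrite /g.
have [_ _ ->] := mkE ((j + T ^+ 2) / a) a T.
by have [_ _ ->] := mkE ((j + T' ^+ 2) / a) a T'.
Qed.

Lemma sphere_opp x : x \in S -> - x \in S.
Proof. by rewrite !inE uN vN tN mulrNN sqrrN. Qed.

(** If [z] and [x + x - z] lie on the sphere, then [x - z] is isotropic and orthogonal to [x]. *)
Lemma card_sphere_double x : x \in S -> #|[set z in S | x + x - z \in S]| = 1%N.
Proof.
move=> xS; rewrite -(cards1 x); apply: eq_card => z; rewrite !inE.
apply/andP/eqP => [[/eqP e1 /eqP]|->]; last first.
  by rewrite addrK; move: xS; rewrite inE.
rewrite !uD !vD !tD uN vN tN => e2.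
have e := sphereP _ xS.
apply/eqP; rewrite eq_sym -subr_eq0; apply/eqP.
apply: (isotropic_orthogonal_eq0 xS); rewrite !uD !vD !tD uN vN tN.
  apply: (mulfI two_neq0); apply/eqP; rewrite -subr_eq0; apply/eqP.
  transitivity ((u x + u x - u z) * (v x + v x - v z) - (t x + t x - t z) ^+ 2
    - 2 * (u x * v x) + 2 * t x ^+ 2 + (u z * v z - t z ^+ 2)); first by ring.
  by rewrite e2 e1 e; ring.
apply: (mulfI two_neq0); apply/eqP; rewrite -subr_eq0; apply/eqP.
transitivity ((u x + u x - u z) * (v x + v x - v z) - (t x + t x - t z) ^+ 2
    - (u z * v z - t z ^+ 2)); first by ring.
by rewrite e2 e1 subrr.
Qed.

(** Multiplying the quadratic equation in [c] by [v s] prescribes the square of [t s + c * v s]. *)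
Lemma card_ruling_zeros s : v s != 0 ->
  #|[set c | ruling c s == 0]| = #|[set z : F | z ^+ 2 == - (u s * v s - t s ^+ 2)]|.
Proof.
move=> vs0; pose g z := Some ((z - t s) / v s) : option F.
rewrite -[RHS](card_imset (f := g)); last first.
  by move=> z z' [/(mulIf (invr_neq0 vs0))/addIr].
apply: eq_card => c; rewrite inE; apply/idP/imsetP => [|[z]].
  case: c => [c|] /=; last by rewrite (negPf vs0).
  move/eqP=> e; exists (t s + c * v s); last by rewrite /g addrC addKr mulfK.
  rewrite inE -subr_eq0; apply/eqP.
  transitivity (v s * (u s + 2 * c * t s + c ^+ 2 * v s)); first by ring.
  by rewrite e mulr0.
rewrite inE => /eqP e -> /=; apply/eqP.
transitivity ((u s * v s - t s ^+ 2 + z ^+ 2) / v s); first by field.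
by rewrite e subrr mul0r.
Qed.

Lemma card_ruling_zeros_v0 s : v s = 0 -> t s != 0 -> #|[set c | ruling c s == 0]| = 2%N.
Proof.
move=> vs0 ts0; set c0 := - u s / (2 * t s).
have -> : [set c | ruling c s == 0] = [set None; Some c0].
  apply/setP=> -[c|]; rewrite !inE /= ?vs0 ?eqxx // mulr0 addr0.
  apply/eqP/eqP => [e|[->]]; last by rewrite /c0; field; rewrite ts0.
  congr Some; rewrite /c0; apply: (mulIf (mulf_neq0 two_neq0 ts0)).
  rewrite divfK ?mulf_neq0 //; apply/eqP; rewrite -addr_eq0 -e; apply/eqP; ring.
by rewrite cards2.
Qed.

Lemma card_ruling_zeros_le2 s : s != 0 -> (#|[set c | ruling c s == 0%R]| <= 2)%N.
Proof.
move=> s0; have [vs0|vs0] := eqVneq (v s) 0; last first.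
  by rewrite card_ruling_zeros // card_sqrts_le2.
have [ts0|ts0] := eqVneq (t s) 0; last by rewrite card_ruling_zeros_v0.
have us0 : u s != 0 by apply: contraNneq s0 => us0; apply/eqP/coords_eq0.
have -> : [set c | ruling c s == 0] = [set None].
  apply/setP=> -[c|]; rewrite !inE /= ?vs0 ?eqxx // ts0 !mulr0 !addr0.
  by rewrite (negPf us0).
by rewrite cards1.
Qed.

(** The terms quadratic in [z] cancel, so the condition cuts a plane section. *)
Lemma sum_sphereE s z : z \in S -> (s - z \in S) =
  (u s * v z + v s * u z - 2 * t s * t z == u s * v s - t s ^+ 2).
Proof.
move/sphereP=> e; rewrite inE !uD !vD !tD uN vN tN.
rewrite -[LHS]subr_eq0 -[RHS]subr_eq0 -[RHS]oppr_eq0; congr (_ == 0).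
by ring: e.
Qed.

Lemma card_sphere_sum x y : x \in S -> y \in S -> x != y -> x + y != 0 ->
  (#|[set z in S | (x + y - z)%R \in S]| + #|[set c | ruling c (x + y)%R == 0%R]|
     = #|F|.+1)%N.
Proof.
move=> xS yS xy; set s := x + y => s0.
have e1 := sphereP _ xS; have e2 := sphereP _ yS.
set D := u s * v s - t s ^+ 2.
(* If [D = 0], then [s] is isotropic and orthogonal to [x]. *)
have D0 : D != 0.
  apply: contraNneq s0 => D0; apply/eqP/(isotropic_orthogonal_eq0 xS).
    by apply/eqP; rewrite -subr_eq0 -/D D0.
  apply/eqP; rewrite -subr_eq0; apply/eqP; move: D0; rewrite /D /s !uD !vD !tD => D0.
  transitivity ((u x + u y) * (v x + v y) - (t x + t y) ^+ 2
    + (u x * v x - t x ^+ 2) - (u y * v y - t y ^+ 2)); first by ring.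
  by rewrite D0 e1 e2; ring.
(* This is minus the form at [x - y]; were it zero, [x - y] would be isotropic and orthogonal to
   [x]. *)
have k0 : D - 4 * j != 0.
  apply: contraNneq xy => k0; rewrite -subr_eq0; apply/eqP/(isotropic_orthogonal_eq0 xS).
    apply/eqP; rewrite -subr_eq0; apply/eqP; move: k0; rewrite /D /s !uD !vD !tD uN vN tN => k0.
    transitivity (- ((u x + u y) * (v x + v y) - (t x + t y) ^+ 2 - 4 * j)
      + 2 * (u x * v x - t x ^+ 2 - j) + 2 * (u y * v y - t y ^+ 2 - j)); first by ring.
    by rewrite k0 e1 e2; ring.
  apply/eqP; rewrite -subr_eq0; apply/eqP; move: k0; rewrite /D /s !uD !vD !tD uN vN tN => k0.
  transitivity (- ((u x + u y) * (v x + v y) - (t x + t y) ^+ 2 - 4 * j)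
    + 3 * (u x * v x - t x ^+ 2 - j) + (u y * v y - t y ^+ 2 - j)); first by ring.
  by rewrite k0 e1 e2; ring.
have [vs0|vs0] := eqVneq (v s) 0.
  have ts0 : t s != 0.
    by apply: contraNneq D0 => ts0; rewrite /D vs0 ts0 mulr0 expr0n subrr.
  rewrite card_ruling_zeros_v0 // addn2; congr _.+1.
  (* As [v s = 0], the plane equation gives [t z] from [b = v z], and the sphere then gives [u z];
     [b] runs over the nonzero elements. *)
  pose gt b := (u s * b + t s ^+ 2) / (2 * t s).
  pose g b := mk ((j + gt b ^+ 2) / b) b (gt b).
  have -> : [set z in S | s - z \in S] = [set g b | b in [set~ 0]].
    apply/setP=> z; rewrite inE; apply/andP/imsetP => [[zS]|[b b0 ->]].
      rewrite sum_sphereE // vs0 => /eqP e; have vz0 := sphere_v_neq0 zS.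
      have tE : gt (v z) = t z.
        apply: (mulIf (mulf_neq0 two_neq0 ts0)).
        rewrite divfK ?mulf_neq0 //; apply/eqP; rewrite -subr_eq0; apply/eqP.
        move/eqP: e; rewrite -subr_eq0 => /eqP <-; ring.
      by exists (v z); rewrite ?inE // /g tE -(sphereP _ zS) mulfK //.
    rewrite !inE in b0; have [gu gv gtt] := mkE ((j + gt b ^+ 2) / b) b (gt b).
    have gS : g b \in S by apply/sphereP; rewrite gu gv gtt divfK.
    split=> //; rewrite sum_sphereE // gu gv gtt vs0 /gt; apply/eqP; field.
    by rewrite ts0 two_neq0.
  rewrite card_imset ?cardsC1 ?prednK //; last first.
    move=> b b' /(congr1 v); rewrite /g.
    have [_ -> _] := mkE ((j + gt b ^+ 2) / b) b (gt b).
    by have [_ -> _] := mkE ((j + gt b' ^+ 2) / b') b' (gt b').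
  by rewrite ltnW // card_finNzRing_gt1.
rewrite card_ruling_zeros // -/D -(card_conic two_neq0 D0 k0); congr (_ + _)%N.
(* In coordinates centred at half of [s], the section becomes [X ^+ 2 + D * Y ^+ 2 = D - 4 * j]. *)
pose gv (Y : F) := v s * (Y + 1) / 2.
pose gt (X Y : F) := X / 2 + t s * (Y + 1) / 2.
pose gu X Y := (D - u s * gv Y + 2 * t s * gt X Y) / v s.
pose g (P : F * F) := mk (gu P.1 P.2) (gv P.2) (gt P.1 P.2).
rewrite -[RHS](card_imset (f := g)); last first.
  move=> [X Y] [X' Y'] e.
  have [_ e2v e2t] := mkE (gu X Y) (gv Y) (gt X Y).
  have [_ e2v' e2t'] := mkE (gu X' Y') (gv Y') (gt X' Y').
  move: (congr1 v e) (congr1 t e); rewrite /g /= e2v e2t e2v' e2t' /gv /gt => ev et.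
  have eY : Y = Y'.
    by apply: (addIr 1); apply: (mulfI vs0); apply: (mulIf (invr_neq0 two_neq0)).
  by move: et; rewrite eY => /addIr/(mulIf (invr_neq0 two_neq0)) ->.
apply: eq_card => z; rewrite inE; apply/andP/imsetP => [[zS]|[[X Y]]].
  rewrite sum_sphereE // -/D => /eqP e; have e3 := sphereP _ zS.
  have eu : u z = (D - u s * v z + 2 * t s * t z) / v s.
    apply: (mulIf vs0); rewrite divfK //; apply/eqP; rewrite -subr_eq0; apply/eqP.
    move/eqP: e; rewrite -subr_eq0 => /eqP <-; ring.
  exists (2 * (t z - t s * v z / v s), 2 * v z / v s - 1).
    rewrite inE /=; apply/eqP.
    have -> : j = u z * v z - t z ^+ 2 by rewrite e3 addrK.
    by rewrite eu /D; field.
  rewrite /g /=.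
  have -> : gv (2 * v z / v s - 1) = v z by rewrite /gv; field; rewrite two_neq0.
  have tE : gt (2 * (t z - t s * v z / v s)) (2 * v z / v s - 1) = t z.
    by rewrite /gt; field; rewrite two_neq0.
  rewrite tE /gu tE -[LHS]mkK {1}eu /gv; congr (mk _ _ _).
  by field; rewrite vs0 two_neq0.
rewrite inE /= => /eqP e ->; rewrite /g /=.
have [e2u e2v e2t] := mkE (gu X Y) (gv Y) (gt X Y).
have gS : g (X, Y) \in S.
  apply/sphereP; rewrite /g /= e2u e2v e2t.
  apply: (mulfI two_neq0); apply: (mulfI two_neq0).
  have e' : 4 * j = D - (X ^+ 2 + D * Y ^+ 2) by rewrite e; ring.
  rewrite mulrDr mulrA -natrM mulrDr mulrA -natrM e' /gu /gv /gt /D; field.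
  by rewrite vs0 two_neq0.
split=> //; rewrite (sum_sphereE _ gS) /g /= e2u e2v e2t -/D /gu; apply/eqP.
by field.
Qed.

Lemma ruled_sphere_coords : ruled_sphere S ruling.
Proof.
split.
- exact: two_neq0.
- exact: sphere_opp.
- by move=> [c|] x y /=; rewrite !(uD, vD, tD) //; ring.
- by move=> c x; apply: ruling_neq0.
- exact: card_ruling_fiber.
- exact: card_ruling_zeros_le2.
- exact: card_sphere_double.
- exact: card_sphere_sum.
Qed.
End Coordinates.

(** A solution of [a ^+ 2 + b ^+ 2 = -1] splits off a hyperbolic plane and turns the sum of three
    squares into [u * v - t ^+ 2]. *)
Lemma ruled_sphere_nonsquare (F : finFieldType) (j : F) :
  2 != 0 :> F -> (forall y : F, y ^+ 2 != - j) ->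
  exists L : option F -> 'rV[F]_3 -> F, ruled_sphere (sphere j) L.
Proof.
move=> two_neq0 nsq.
have [a [b]] := binary_form_universal two_neq0 (-1) (oner_neq0 F).
rewrite mul1r => ab.
pose i0 : 'I_3 := inord 0; pose i1 : 'I_3 := inord 1; pose i2 : 'I_3 := inord 2.
have sum3 (G : 'I_3 -> F) : \sum_(i < 3) G i = G i0 + G i1 + G i2.
  rewrite !big_ord_recr big_ord0 /= add0r; congr (G _ + G _ + G _); apply: val_inj;
    by rewrite /= inordK.
pose u (x : 'rV[F]_3) := a * x 0 i0 + b * x 0 i1 - x 0 i2.
pose v (x : 'rV[F]_3) := - (a * x 0 i0 + b * x 0 i1 + x 0 i2).
pose t (x : 'rV[F]_3) := b * x 0 i0 - a * x 0 i1.
(* The inverse change of coordinates; the first two entries use [a ^+ 2 + b ^+ 2 = -1]. *)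
pose mk (p q r : F) : 'rV[F]_3 := \row_(i < 3)
  [:: - (a * ((p - q) / 2) + b * r); - (b * ((p - q) / 2) - a * r); - (p + q) / 2]`_i.
have -> : sphere j = [set x | u x * v x - t x ^+ 2 == j].
  apply/setP=> x; rewrite !inE sum3; congr (_ == j); rewrite /u /v /t.
  have -> : x 0 i0 ^+ 2 + x 0 i1 ^+ 2 + x 0 i2 ^+ 2 =
    (- -1) * (x 0 i0 ^+ 2 + x 0 i1 ^+ 2) + x 0 i2 ^+ 2 by ring.
  by rewrite -ab; ring.
have ab' : b ^+ 2 = -1 - a ^+ 2 by rewrite -ab addrC addKr.
exists (ruling u v t); apply: (ruled_sphere_coords (mk := mk)) => //.
- by move=> x y; rewrite /u !mxE; ring.
- by move=> x y; rewrite /v !mxE; ring.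
- by move=> x y; rewrite /t !mxE; ring.
- move=> p q r; rewrite /u /v /t !mxE /= !inordK //=; by split; field: ab'.
- move=> x; apply/rowP=> i; rewrite !mxE; case: i => [[|[|[|//]]] lti] /=.
  + have -> : Ordinal lti = i0 by apply: val_inj; rewrite /= inordK.
    by rewrite /u /v /t; field: ab'.
  + have -> : Ordinal lti = i1 by apply: val_inj; rewrite /= inordK.
    by rewrite /u /v /t; field: ab'.
  + have -> : Ordinal lti = i2 by apply: val_inj; rewrite /= inordK.
    by rewrite /u /v /t; field.
Qed.

(** * Variance and Cauchy-Schwarz for real sums *)

Section RealSums.
Variable R : realFieldType.

Lemma sum_variance (I : finType) (A : {set I}) (x : I -> R) : (0 < #|A|)%N ->
  \sum_(i in A) (x i - (\sum_(k in A) x k) / #|A|%:R) ^+ 2 =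
  \sum_(i in A) x i ^+ 2 - (\sum_(k in A) x k) ^+ 2 / #|A|%:R.
Proof.
move=> A0; have nA : #|A|%:R != 0 :> R by rewrite pnatr_eq0 -lt0n.
set X := \sum_(k in A) x k; set m := X / _.
transitivity (\sum_(i in A) x i ^+ 2 - 2 * m * X + m ^+ 2 * #|A|%:R); last first.
  by rewrite /m; field.
rewrite /X mulr_sumr -sumrB mulr_natr -sumr_const -big_split /=.
by apply: eq_bigr => i _; ring.
Qed.

Lemma sqr_sum_le (I : finType) (A : {set I}) (x : I -> R) : (0 < #|A|)%N ->
  (\sum_(i in A) x i) ^+ 2 / #|A|%:R <= \sum_(i in A) x i ^+ 2.
Proof.
move=> A0; rewrite -subr_ge0 -sum_variance //.
by apply: sumr_ge0 => i _; apply: sqr_ge0.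
Qed.

(* Triangle inequality in the plane for the vectors (p i, v i) of length w i. *)
Lemma sum_sqr_minkowski (I : finType) (p v w : I -> R) :
  (forall i, 0 <= w i) -> (forall i, w i ^+ 2 = p i ^+ 2 + v i ^+ 2) ->
  (\sum_i p i) ^+ 2 + (\sum_i v i) ^+ 2 <= (\sum_i w i) ^+ 2.
Proof.
move=> w0 wE; rewrite !expr2 !big_distrlr -big_split /=.
apply: ler_sum => i _; rewrite -big_split /=; apply: ler_sum => k _.
rewrite (le_trans (ler_norm _)) // -ler_sqr ?nnegrE ?mulr_ge0 //.
rewrite real_normK ?num_real // exprMn !wE -subr_ge0.
have -> : (p i ^+ 2 + v i ^+ 2) * (p k ^+ 2 + v k ^+ 2) - (p i * p k + v i * v k) ^+ 2
  = (p i * v k - v i * p k) ^+ 2 by ring.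
exact: sqr_ge0.
Qed.

Lemma odd_sum0 (V : finZmodType) (g : V -> R) :
  (forall x, g (- x) = - g x) -> \sum_x g x = 0.
Proof.
move=> gN; have e : \sum_x g x = - \sum_x g x.
  rewrite -sumrN [LHS](reindex_inj oppr_inj) /=.
  by apply: eq_bigr => x _; rewrite gN.
lra.
Qed.
End RealSums.

(** * Energy bound for nonnegative functions on a ruled sphere *)

Section Energy.
Variables (R : realFieldType) (F : finFieldType) (V : finZmodType).
Variables (S : {set V}) (L : option F -> V -> F).
Hypothesis rS : ruled_sphere S L.
Local Notation q := #|F|.

Definition zeros s := #|[set c | L c s == 0]|.

Lemma ruling0 c : L c 0 = 0.
Proof. by apply: (addIr (L c 0)); rewrite -(rs_add rS) !add0r. Qed.

Lemma rulingN c x : L c (- x) = - L c x.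
Proof. by apply: (addrI (L c x)); rewrite -(rs_add rS) !subrr ruling0. Qed.

Lemma zeros0 : zeros 0 = q.+1.
Proof.
by rewrite /zeros -card_option -cardsT; apply: eq_card => c; rewrite !inE ruling0 eqxx.
Qed.

Lemma zerosN s : zeros (- s) = zeros s.
Proof. by apply: eq_card => c; rewrite !inE rulingN oppr_eq0. Qed.

(** A single line already partitions [S] into [q - 1] fibers of size [q]. *)
Lemma card_ruled_sphere : #|S| = (q * q.-1)%N.
Proof.
rewrite -sum1_card (partition_big (L None) (predC1 0)) /=; last first.
  by move=> x /(rs_neq0 rS).
rewrite -(cardC1 (0 : F)) mulnC -sum_nat_const; apply: eq_bigr => a a0.
rewrite -(rs_fiber rS None a0) -sum1_card.
by apply: eq_bigl => x; rewrite inE.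
Qed.

Let q_gt1 : (1 < q)%N := card_finNzRing_gt1 F.

Lemma card_ruled_sphere_gt0 : (0 < #|S|)%N.
Proof. by rewrite card_ruled_sphere; lia. Qed.

Let supp (g : V -> R) := forall x, x \notin S -> g x = 0.

(** The polarization of B from the overview; [zeros] is its n. *)
Definition ruled_form (g h : V -> R) : R :=
  \sum_x \sum_y (zeros (x + y))%:R * (g x * h y).

(** Expand [zeros] over the lines: [x + y] is orthogonal to a line when [x] and [y] have opposite
    pairings with it. *)
Lemma ruled_formE (g : V -> R) : ruled_form g g =
  \sum_c \sum_a (\sum_(x | L c x == a) g x) * (\sum_(x | L c x == - a) g x).
Proof.
transitivity (\sum_x \sum_y \sum_(c | L c (x + y) == 0) g x * g y).
  apply: eq_bigr => x _; apply: eq_bigr => y _.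
  by rewrite sumr_const mulr_natl /zeros cardsE.
transitivity (\sum_x \sum_c \sum_(y | L c (x + y) == 0) g x * g y).
  apply: eq_bigr => x _; under eq_bigr do rewrite big_mkcond.
  by rewrite exchange_big /=; under eq_bigr do rewrite -big_mkcond.
rewrite exchange_big /=; apply: eq_bigr => c _.
rewrite (partition_big (L c) xpredT) //=; apply: eq_bigr => a _.
rewrite mulr_suml; apply: eq_bigr => x /eqP xa; rewrite mulr_sumr.
by apply: eq_bigl => y; rewrite (rs_add rS) xa addrC addr_eq0.
Qed.

(** For each of the [q + 1] lines, class 0 has no mass and the classes [a] and [- a] have equal
    mass, so the line contributes a sum of [q - 1] squares, bounded below by Cauchy-Schwarz. *)
Lemma ruled_form_even_ge (w : V -> R) : supp w -> (forall x, w (- x) = w x) ->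
  (q%:R + 1) / (q%:R - 1) * (\sum_x w x) ^+ 2 <= ruled_form w w.
Proof.
move=> sw wN; rewrite ruled_formE.
have -> : (q%:R + 1) / (q%:R - 1) * (\sum_x w x) ^+ 2 =
   \sum_(c : option F) (\sum_x w x) ^+ 2 / (q%:R - 1).
  by rewrite sumr_const card_option -[RHS]mulr_natl -natr1; ring.
apply: ler_sum => c _.
pose b a := \sum_(x | L c x == a) w x.
have b0 : b 0 = 0.
  apply: big1 => x /eqP xc; apply: sw; apply: contra_eqN xc; exact: rs_neq0.
have bN a : \sum_(x | L c x == - a) w x = b a.
  rewrite (reindex_inj oppr_inj) /=; apply: eq_big => x //.
  by rewrite rulingN eqr_opp.
have -> : \sum_x w x = \sum_(a in [set~ 0]) b a.
  rewrite (partition_big (L c) xpredT) //= -/(b _) (bigD1 0) //= -/(b 0) b0 add0r.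
  by apply: eq_bigl => a; rewrite !inE.
have -> : \sum_a (\sum_(x | L c x == a) w x) * (\sum_(x | L c x == - a) w x) =
    \sum_(a in [set~ 0]) b a ^+ 2.
  under eq_bigr do rewrite bN -/(b _) -expr2.
  rewrite (bigD1 0) //= b0 expr0n add0r.
  by apply: eq_bigl => a; rewrite !inE.
have -> : q%:R - 1 = #|[set~ (0 : F)]|%:R :> R.
  by rewrite cardsC1 -subn1 natrB // ltnW.
by apply: sqr_sum_le; rewrite cardsC1 -subn1 subn_gt0.
Qed.

(** Since [v] has sum zero, [zeros] may be replaced by [zeros - 1], which lies in [-1, 1] off the
    antipodal pairs and equals [q] on them. The first term on the left removes the antipodal pairs
    from the squared sum. *)
Lemma ruled_form_odd_ge (v : V -> R) : (forall x, v (- x) = - v x) ->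
  \sum_x v x ^+ 2 - (\sum_x `|v x|) ^+ 2 - q%:R * \sum_x v x ^+ 2 <= ruled_form v v.
Proof.
move=> vN.
have v00 : v 0 = 0 by have := vN 0; rewrite oppr0; lra.
have -> : ruled_form v v = \sum_x \sum_y ((zeros (x + y))%:R - 1) * (v x * v y).
  apply/esym; under eq_bigr do under eq_bigr do rewrite mulrBl mul1r.
  under eq_bigr do rewrite sumrB.
  by rewrite sumrB -big_distrlr /= (odd_sum0 vN) mul0r subr0.
rewrite expr2 big_distrlr /= mulr_sumr -!sumrB; apply: ler_sum => x _.
rewrite (bigD1 (- x)) //= [leRHS](bigD1 (- x)) //= subrr zeros0 vN normrN.
have -> : `|v x| * `|v x| = v x ^+ 2 by rewrite -expr2 real_normK ?num_real.
have H : - \sum_(i | i != - x) `|v x| * `|v i| <=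
    \sum_(i | i != - x) ((zeros (x + i))%:R - 1) * (v x * v i).
  rewrite -sumrN; apply: ler_sum => y yx.
  have xy0 : x + y != 0 by rewrite addrC addr_eq0.
  rewrite -normrM lerNl (le_trans (ler_norm _)) // normrN [leLHS]normrM ler_piMl //.
  have := rs_zeros rS xy0; rewrite -/(zeros _).
  by rewrite -(ler_nat R) ler_norml => ?; have := ler0n R (zeros (x + y)); lra.
by rewrite -natr1; move: H; nra.
Qed.

(** As [zeros] is even, the cross terms are sums of odd functions. *)
Lemma ruled_form_split (w v : V -> R) :
  (forall x, w (- x) = w x) -> (forall x, v (- x) = - v x) ->
  ruled_form (fun x => w x + v x) (fun x => w x + v x) = ruled_form w w + ruled_form v v.
Proof.
move=> wN vN.
have e : \sum_x \sum_y (zeros (x + y))%:R * (w x * v y) = 0.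
  apply: odd_sum0 => x; rewrite -sumrN [LHS](reindex_inj oppr_inj) /=.
  by apply: eq_bigr => y _; rewrite -opprD zerosN wN vN !mulrN.
have e' : \sum_x \sum_y (zeros (x + y))%:R * (v x * w y) = 0.
  apply: odd_sum0 => x; rewrite -sumrN [LHS](reindex_inj oppr_inj) /=.
  by apply: eq_bigr => y _; rewrite -opprD zerosN wN vN mulNr mulrN.
transitivity (ruled_form w w + ruled_form v v +
    (\sum_x \sum_y (zeros (x + y))%:R * (w x * v y) +
     \sum_x \sum_y (zeros (x + y))%:R * (v x * w y))); last by rewrite e e' !addr0.
rewrite /ruled_form -!big_split /=.
apply: eq_bigr => x _; rewrite -!big_split /=.
by apply: eq_bigr => y _; ring.
Qed.

Definition even_sq (a : V -> R) x := (a x ^+ 2 + a (- x) ^+ 2) / 2.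
Definition odd_sq (a : V -> R) x := (a x ^+ 2 - a (- x) ^+ 2) / 2.

(* The last two terms of the left-hand side are the deficit: they vanish only if
   [a] is constant on S. *)
Lemma energy_stability (a : V -> R) : supp a -> (forall x, 0 <= a x) ->
  (\sum_x a x * a (- x)) ^+ 2 + (q%:R + 1) * (\sum_x a x ^+ 2) ^+ 2
   - ruled_form (fun x => a x ^+ 2) (fun x => a x ^+ 2) - q%:R * \sum_x a x ^+ 4
   + (\sum_x odd_sq a x ^+ 2
      + q%:R * \sum_(x in S) (even_sq a x - (\sum_x a x ^+ 2) / #|S|%:R) ^+ 2)
  <= (q%:R + 1 - 3 / (q%:R - 1)) * (\sum_x a x ^+ 2) ^+ 2.
Proof.
move=> sa a0; set W := \sum_x a x ^+ 2.
pose w := even_sq a; pose v := odd_sq a; rewrite -/w -/v.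
have wN x : w (- x) = w x by rewrite /w /even_sq opprK addrC.
have vN x : v (- x) = - v x by rewrite /v /odd_sq opprK; lra.
have w0 x : 0 <= w x by rewrite /w /even_sq divr_ge0 ?addr_ge0 ?exprn_ge0.
have sw : supp w.
  move=> x xS; rewrite /w /even_sq !sa ?expr0n ?addr0 ?mul0r //.
  by apply: contraNN xS => /(rs_opp rS); rewrite opprK.
have uE x : a x ^+ 2 = w x + v x by rewrite /w /v /even_sq /odd_sq; lra.
have EW : W = \sum_x w x.
  rewrite /W (eq_bigr _ (fun x _ => uE x)) big_split /= (odd_sum0 vN) addr0 //.
have EB : ruled_form (fun x => a x ^+ 2) (fun x => a x ^+ 2) = ruled_form w w + ruled_form v v.
  rewrite -ruled_form_split // /ruled_form.
  by apply: eq_bigr => x _; apply: eq_bigr => y _; rewrite !uE.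
have E4 : \sum_x a x ^+ 4 = \sum_x w x ^+ 2 + \sum_x v x ^+ 2.
  have e : \sum_x 2 * (w x * v x) = 0.
    by apply: odd_sum0 => x; rewrite wN vN !mulrN.
  transitivity (\sum_x w x ^+ 2 + \sum_x v x ^+ 2 + \sum_x 2 * (w x * v x)); last first.
    by rewrite e addr0.
  rewrite -!big_split /=; apply: eq_bigr => x _.
  by rewrite (exprM _ 2 2) uE; ring.
have WS : \sum_(x in S) w x = W.
  rewrite EW [RHS](bigID (mem S)) /= [X in _ = _ + X]big1 ?addr0 // => x; exact: sw.
have ws : \sum_(x in S) w x ^+ 2 = \sum_x w x ^+ 2.
  rewrite [RHS](bigID (mem S)) /= [X in _ = _ + X]big1 ?addr0 // => x xS.
  by rewrite sw // expr0n.
rewrite -WS sum_variance ?card_ruled_sphere_gt0 // ws WS EB E4.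
(* Uses [w x ^+ 2 = (a x * a (- x)) ^+ 2 + v x ^+ 2]. *)
have Mk : (\sum_x a x * a (- x)) ^+ 2 + (\sum_x `|v x|) ^+ 2 <= W ^+ 2.
  rewrite EW; apply: sum_sqr_minkowski => // x.
  by rewrite real_normK ?num_real // /w /v /even_sq /odd_sq; field.
have He := ruled_form_even_ge sw wN; have Ho := ruled_form_odd_ge vN.
rewrite -EW in He.
have -> : #|S|%:R = q%:R * (q%:R - 1) :> R.
  by rewrite card_ruled_sphere natrM -subn1 natrB // ltnW.
have q1 : q%:R - 1 != 0 :> R by rewrite subr_eq0 pnatr_eq1; lia.
have q0 : q%:R != 0 :> R by rewrite pnatr_eq0; lia.
(* The four terms come from Minkowski, from the main term, from the form of the even part, and from
   comparing its sum of squares with [W ^+ 2 / #|S|]. *)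
have e1 : (q%:R + 1 - 3 / (q%:R - 1)) * W ^+ 2 =
  W ^+ 2 + (q%:R + 1) * W ^+ 2 - (q%:R + 1) / (q%:R - 1) * W ^+ 2
  - q%:R * (W ^+ 2 / (q%:R * (q%:R - 1))).
  by field; rewrite q1 q0.
rewrite e1; move: He Ho Mk; set T := W ^+ 2 / (_ * _); rewrite mulrBr !mulrDr; lra.
Qed.

Definition reps s := #|[set z in S | s - z \in S]|.

Lemma sum_pairs (h : V -> V -> V -> R) :
  \sum_s \sum_x h s x (s - x) = \sum_x \sum_y h (x + y) x y.
Proof.
rewrite exchange_big /=; apply: eq_bigr => x _.
rewrite (reindex_inj (addrI x)) /=.
by apply: eq_bigr => y _; rewrite addrAC subrr add0r.
Qed.

Lemma ruling_double_neq0 c x : x \in S -> L c (x + x) != 0.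
Proof.
move=> xS; rewrite (rs_add rS) -mulr2n -mulr_natl mulf_neq0 ?(rs_odd rS) //.
exact: (rs_neq0 rS).
Qed.

(** When [x] and [s - x] lie in [S], [reps s] is [q + 1 - zeros s], unless [s = x + x], where
    [reps s = 1] and [zeros s = 0]; hence the correction by [q]. *)
Lemma reps_weight (g : V -> R) s x : supp g -> s != 0 ->
  (reps s)%:R * (g x * g (s - x)) =
  (q%:R + 1 - (zeros s)%:R - (if x == s - x then q%:R else 0)) * (g x * g (s - x)).
Proof.
move=> sg s0.
have [xS|/sg->] := boolP (x \in S); last by rewrite !(mul0r, mulr0).
have [yS|/sg->] := boolP (s - x \in S); last by rewrite !(mul0r, mulr0).
congr (_ * _); have [e|xy] := eqVneq x (s - x).
  have es : s = x + x by rewrite {2}e addrCA subrr addr0.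
  have -> : reps s = 1%N by rewrite es; apply: rs_double rS _ xS.
  have -> : zeros s = 0%N.
    apply/eqP; rewrite cards_eq0; apply/eqP/setP => c; rewrite !inE es.
    exact/negbTE/ruling_double_neq0.
  lra.
have := rs_sum rS xS yS xy; rewrite addrCA subrr addr0 -/(reps s) -/(zeros s) => /(_ s0) e.
by rewrite subr0 natr1 -e natrD addrK.
Qed.

Lemma sum_reps (g : V -> R) : supp g ->
  \sum_(s | s != 0) (reps s)%:R * (\sum_x g x * g (s - x)) =
  (q%:R + 1) * (\sum_x g x) ^+ 2 - ruled_form g g - q%:R * \sum_x g x ^+ 2.
Proof.
move=> sg.
pose h s x y := (q%:R + 1 - (zeros s)%:R - (if x == y then q%:R else 0)) * (g x * g y).
transitivity (\sum_s \sum_x h s x (s - x)).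
  (* The sum extends to [s = 0]: there [zeros 0 = q + 1] and no point of [S] is its own opposite, so
     the term vanishes. *)
  rewrite [RHS](bigD1 0) //= [X in _ = X + _]big1 ?add0r; last first.
    move=> x _; rewrite /h sub0r zeros0 -natr1.
    have [xS|/sg->] := boolP (x \in S); last by rewrite !(mul0r, mulr0).
    have [e|_] := eqVneq x (- x); last by rewrite subrr subr0 mul0r.
    have := ruling_double_neq0 None xS.
    by rewrite {2}e subrr ruling0 eqxx.
  by apply: eq_bigr => s s0; rewrite mulr_sumr; apply: eq_bigr => x _; apply: reps_weight.
rewrite sum_pairs expr2 big_distrlr /= !mulr_sumr /ruled_form -!sumrB.
apply: eq_bigr => x _; rewrite mulr_sumr.
have -> : q%:R * g x ^+ 2 = \sum_y (if x == y then q%:R else 0) * (g x * g y).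
  rewrite (bigD1 x) //= eqxx big1 ?addr0 ?expr2 // => y yx.
  by rewrite eq_sym (negPf yx) mul0r.
by rewrite -!sumrB; apply: eq_bigr => y _; rewrite /h !mulrBl.
Qed.

(** Cauchy-Schwarz over the [reps s] terms that can be nonzero. *)
Lemma sqr_convolution_le (a : V -> R) s : supp a ->
  (\sum_x a x * a (s - x)) ^+ 2 <= (reps s)%:R * \sum_x a x ^+ 2 * a (s - x) ^+ 2.
Proof.
move=> sa; pose A := [set z in S | s - z \in S].
have sumA (g : V -> R) : supp g ->
    \sum_x g x * g (s - x) = \sum_(x in A) g x * g (s - x).
  move=> sg; rewrite [LHS](bigID (mem A)) /= [X in _ + X]big1 ?addr0 // => x.
  by rewrite inE negb_and => /orP[]/sg ->; rewrite ?mul0r ?mulr0.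
rewrite sumA // (sumA (fun x => a x ^+ 2)); last by move=> x /sa ->; rewrite expr0n.
have [A0|A0] := posnP #|A|.
  by rewrite (cards0_eq A0) !big_set0 expr0n mulr0.
rewrite -[reps s]/(#|A|) mulrC -ler_pdivrMr ?ltr0n //.
apply: le_trans (sqr_sum_le _ A0) _.
by apply: ler_sum => x _; rewrite exprMn.
Qed.

Lemma energy_le (a : V -> R) : supp a -> (forall x, 0 <= a x) ->
  \sum_s (\sum_x a x * a (s - x)) ^+ 2 +
  (\sum_x odd_sq a x ^+ 2
   + q%:R * \sum_(x in S) (even_sq a x - (\sum_x a x ^+ 2) / #|S|%:R) ^+ 2)
  <= (q%:R + 1 - 3 / (q%:R - 1)) * (\sum_x a x ^+ 2) ^+ 2.
Proof.
move=> sa a0; apply: le_trans (energy_stability sa a0); rewrite lerD2r.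
have sa2 : supp (fun x => a x ^+ 2) by move=> x /sa ->; rewrite expr0n.
have -> : \sum_x a x ^+ 4 = \sum_x (a x ^+ 2) ^+ 2.
  by apply: eq_bigr => x _; rewrite -exprM.
apply: (@le_trans _ _ ((\sum_x a x * a (- x)) ^+ 2 +
    \sum_(s | s != 0) (reps s)%:R * (\sum_x a x ^+ 2 * a (s - x) ^+ 2))).
  (* The term [s = 0] is kept exactly; Cauchy-Schwarz is applied only to the others. *)
  rewrite (bigD1 0) //= lerD //; first by under eq_bigr do rewrite sub0r.
  by apply: ler_sum => s _; apply: sqr_convolution_le.
by rewrite (sum_reps sa2) !addrA.
Qed.

(** The energy of the indicator function of [S], which attains the bound of [energy_le]. *)
Lemma sum_sqr_reps :
  \sum_s (reps s)%:R ^+ 2 = (q%:R + 1 - 3 / (q%:R - 1)) * #|S|%:R ^+ 2 :> R.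
Proof.
pose g x : R := (x \in S)%:R.
have sg : supp g by move=> x /negPf xS; rewrite /g xS.
have gg x : g x ^+ 2 = g x by rewrite /g; case: (x \in S); rewrite ?expr1n ?expr0n.
have sumg : \sum_x g x = #|S|%:R.
  by rewrite /g -natr_sum -sum1_card [in RHS]big_mkcond.
have convg s : \sum_x g x * g (s - x) = (reps s)%:R.
  rewrite /g /reps -sum1_card natr_sum [RHS]big_mkcond /=; apply: eq_bigr => x _.
  by rewrite inE -natrM mulnb; case: (_ && _).
have r0 : reps 0 = #|S|.
  apply: eq_card => x; rewrite inE sub0r.
  by case: (boolP (x \in S)) => // /(rs_opp rS) ->.
have := sum_reps sg; under eq_bigr do rewrite convg -expr2.
rewrite (eq_bigr g (fun x _ => gg x)) sumg => e; rewrite (bigD1 0) //= e r0 ruled_formE.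
(* Each of the [q + 1] lines has [q - 1] nonzero classes, of [q] points each. *)
have -> : \sum_c \sum_a (\sum_(x | L c x == a) g x) * (\sum_(x | L c x == - a) g x)
   = (q%:R + 1) * (q%:R - 1) * q%:R ^+ 2 :> R.
  have fib c a : a != 0 -> \sum_(x | L c x == a) g x = q%:R.
    move=> a0; rewrite -(rs_fiber rS c a0) -sum1_card natr_sum big_mkcond [RHS]big_mkcond /=.
    by apply: eq_bigr => x _; rewrite inE /g andbC; case: (L c x == a); case: (x \in S).
  transitivity (\sum_(c : option F) (q%:R - 1) * q%:R ^+ 2 : R).
    apply: eq_bigr => c _; rewrite (bigD1 0) //= big1 ?mul0r ?add0r; last first.
      move=> x /eqP xc; apply: sg; apply: contra_eqN xc; exact: rs_neq0.
    transitivity (\sum_(a in predC1 (0 : F)) (q%:R ^+ 2 : R)).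
      by apply: eq_bigr => a a0; rewrite !fib ?oppr_eq0.
    by rewrite sumr_const cardC1 -[LHS]mulr_natl -subn1 natrB // ltnW.
  by rewrite sumr_const card_option -[LHS]mulr_natl -natr1; ring.
have -> : #|S|%:R = q%:R * (q%:R - 1) :> R.
  by rewrite card_ruled_sphere natrM -subn1 natrB // ltnW.
have q1 : q%:R - 1 != 0 :> R by rewrite subr_eq0 pnatr_eq1; lia.
by field.
Qed.
End Energy.

(** * The real-valued modulus of complex numbers *)

Section Modulus.
Variable R : realType.

Lemma modulusE (z : R[i]) : `|z| = (modulus z)%:C.
Proof. by case: z. Qed.

Lemma modulus_ge0 (z : R[i]) : 0 <= modulus z.
Proof. by case: z => x y; apply: sqrtr_ge0. Qed.

Lemma modulusX (z : R[i]) n : modulus (z ^+ n) = modulus z ^+ n.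
Proof. by apply: (@complexI R); rewrite rmorphXn /= -!modulusE normrX. Qed.

Lemma modulus_sqr (z : R[i]) : (modulus z ^+ 2)%:C = z * (z^*)%R.
Proof. by rewrite rmorphXn /= -modulusE sqr_normc. Qed.

Lemma modulus_real (r : R) : 0 <= r -> modulus r%:C = r.
Proof. by move=> r0; rewrite /= expr0n addr0 sqrtr_sqr ger0_norm. Qed.

Lemma modulus_nat n : modulus n%:R = n%:R :> R.
Proof. by rewrite -(rmorph_nat (real_complex R)) modulus_real. Qed.

Lemma modulus_sum (I : finType) (f : I -> R[i]) :
  modulus (\sum_i f i) <= \sum_i modulus (f i).
Proof.
rewrite -lecR -modulusE rmorph_sum /=.
by apply: le_trans (ler_norm_sum _ _ _) _; apply: ler_sum => i _; rewrite modulusE.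
Qed.
End Modulus.

(** * Bilinearity and nondegeneracy of the dot product *)

Section Dot.
Variable F : finFieldType.
Implicit Types x y z : 'rV[F]_3.

Lemma dotDl x y z : dot (x + y) z = dot x z + dot y z.
Proof. by rewrite /dot -big_split; apply: eq_bigr => i _; rewrite mxE mulrDl. Qed.

Lemma dotDr x y z : dot z (x + y) = dot z x + dot z y.
Proof. by rewrite /dot -big_split; apply: eq_bigr => i _; rewrite mxE mulrDr. Qed.

Lemma dot0l z : dot 0 z = 0.
Proof. by rewrite /dot big1 // => i _; rewrite mxE mul0r. Qed.

Lemma dotNl x z : dot (- x) z = - dot x z.
Proof. by rewrite /dot -sumrN; apply: eq_bigr => i _; rewrite mxE mulNr. Qed.

Lemma dot_surjective x a : x != 0 -> exists z, dot x z = a.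
Proof.
move=> /rV0Pn[i xi]; exists (\row_k if k == i then a / x 0 i else 0).
rewrite /dot (bigD1 i) //= mxE eqxx mulrC divfK // big1 ?addr0 // => k ki.
by rewrite mxE (negPf ki) mulr0.
Qed.
End Dot.

(** * Fourier analysis on F^3 *)

Section Fourier.
Variables (R : realType) (F : finFieldType) (chi : F -> R[i]).
Hypothesis chi_char : nonprincipal_additive_character chi.
Local Notation V := 'rV[F]_3.

Lemma charD x y : chi (x + y) = chi x * chi y.
Proof. by case: chi_char => D _ _. Qed.

Lemma char_neq0 x : chi x != 0.
Proof.
case: chi_char => _ /(_ x) m1 _; apply/negP => /eqP x0; move: m1.
by rewrite x0 Normc.normc0 => /esym/eqP; rewrite oner_eq0.
Qed.

Lemma char0 : chi 0 = 1.
Proof. by apply: (mulfI (char_neq0 0)); rewrite -charD addr0 mulr1. Qed.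

Lemma charN x : chi (- x) = ((chi x)^*)%R.
Proof.
apply: (mulfI (char_neq0 x)); rewrite -charD subrr char0 -modulus_sqr.
by case: chi_char => _ -> _; rewrite expr1n.
Qed.

(** For [m != 0], translation by a [z] with [chi (dot m z) != 1] multiplies the sum by that
    value. *)
Lemma sum_char (m : V) :
  \sum_x chi (dot m x) = if m == 0 then #|F|%:R ^+ 3 else 0.
Proof.
case: eqVneq => [->|m0].
  under eq_bigr do rewrite dot0l char0.
  by rewrite sumr_const card_mx mul1n natrX.
case: chi_char => _ _ [y y1]; have [z zE] := dot_surjective y m0.
have e : \sum_x chi (dot m x) = chi y * \sum_x chi (dot m x).
  rewrite [LHS](reindex_inj (addrI z)) /= mulr_sumr.
  by apply: eq_bigr => x _; rewrite dotDr zE charD.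
apply/eqP; have /eqP := e; rewrite -subr_eq0 -{1}[\sum_x _]mul1r -mulrBl mulf_eq0.
by rewrite subr_eq0 eq_sym (negPf y1).
Qed.

Lemma parseval (G : V -> R[i]) :
  \sum_x modulus (\sum_s G s * chi (dot s x)) ^+ 2 =
  #|F|%:R ^+ 3 * \sum_s modulus (G s) ^+ 2.
Proof.
apply: (@complexI R); rewrite rmorphM /= !rmorph_sum rmorphXn rmorph_nat /=.
transitivity (\sum_x \sum_s \sum_t G s * ((G t)^*)%R * chi (dot (s - t) x)).
  apply: eq_bigr => x _; rewrite modulus_sqr rmorph_sum big_distrlr /=.
  apply: eq_bigr => s _; apply: eq_bigr => t _.
  by rewrite rmorphM /= -charN -dotNl dotDl charD mulrACA.
rewrite exchange_big /= mulr_sumr; apply: eq_bigr => s _.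
rewrite exchange_big /= (bigD1 s) //= [X in _ + X]big1 ?addr0 => [|t ts].
  by rewrite -mulr_sumr sum_char subrr eqxx modulus_sqr mulrC.
by rewrite -mulr_sumr sum_char subr_eq0 eq_sym (negPf ts) mulr0.
Qed.

(** The square of the transform of [f] is the transform of its self-convolution, to which [parseval]
    applies. *)
Lemma fourth_moment (f : V -> R[i]) :
  \sum_x modulus (\sum_y f y * chi (dot y x)) ^+ 4 =
  #|F|%:R ^+ 3 * \sum_s modulus (\sum_x f x * f (s - x)) ^+ 2.
Proof.
rewrite -parseval; apply: eq_bigr => x _.
rewrite (exprM _ 2 2) -modulusX; congr (modulus _ ^+ 2).
rewrite expr2 big_distrlr /=; under [RHS]eq_bigr do rewrite mulr_suml.
rewrite [RHS]exchange_big /=; apply: eq_bigr => y _.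
rewrite [RHS](reindex_inj (addrI y)) /=; apply: eq_bigr => z _.
by rewrite [y + z - y]addrAC subrr add0r dotDl charD mulrACA.
Qed.
End Fourier.

(** * Norms expressed through additive energy *)

Section Norms.
Variables (R : realType) (F : finFieldType) (chi : F -> R[i]).
Hypothesis chi_char : nonprincipal_additive_character chi.
Variables (S : {set 'rV[F]_3}).
Implicit Types f : points S -> R[i].

(** Convolution needs functions on the whole group, since [s - x] may leave [S]. *)
Definition zero_extension f (x : 'rV[F]_3) : R[i] :=
  if insub x is Some p then f p else 0.

Lemma zero_extension_val f p : zero_extension f (val p) = f p.
Proof. by rewrite /zero_extension valK. Qed.

Lemma zero_extension_out f x : x \notin S -> zero_extension f x = 0.
Proof. by move=> xS; rewrite /zero_extension insubN. Qed.

Lemma sum_points (M : nmodType) (g : 'rV[F]_3 -> M) :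
  (forall x, x \notin S -> g x = 0) -> \sum_(p : points S) g (val p) = \sum_x g x.
Proof.
move=> g0; rewrite [RHS](bigID (mem S)) /= [X in _ + X]big1 // addr0.
exact/esym/big_sub.
Qed.

Lemma L4norm_extension f : L4norm (extension chi f) ^+ 4 =
  #|F|%:R ^+ 3 / #|S|%:R ^+ 4 *
  \sum_s modulus (\sum_x zero_extension f x * zero_extension f (s - x)) ^+ 2.
Proof.
rewrite /L4norm -powR_mulrn ?powR_ge0 // -powRrM mulVf ?pnatr_eq0 // powRr1; last first.
  by apply: sumr_ge0 => x _; rewrite exprn_ge0 ?modulus_ge0.
rewrite mulrAC -(fourth_moment chi_char) mulr_suml; apply: eq_bigr => x _.
rewrite /extension Normc.normcM Normc.normcV modulus_nat exprMn exprVn mulrC.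
congr (modulus _ ^+ 4 / _).
rewrite -(sum_points (g := fun y => zero_extension f y * chi (dot y x))).
  by apply: eq_bigr => p _; rewrite zero_extension_val.
by move=> y /zero_extension_out ->; rewrite mul0r.
Qed.

Lemma L2norm_zero_extension f : L2norm f ^+ 4 =
  (\sum_x modulus (zero_extension f x) ^+ 2) ^+ 2 / #|S|%:R ^+ 2.
Proof.
rewrite /L2norm (exprM _ 2 2) sqr_sqrtr; last first.
  rewrite mulr_ge0 ?invr_ge0 ?ler0n //.
  by apply: sumr_ge0 => p _; rewrite exprn_ge0 ?modulus_ge0.
rewrite exprMn exprVn mulrC; congr (_ ^+ 2 / _).
rewrite -(sum_points (g := fun y => modulus (zero_extension f y) ^+ 2)).
  by apply: eq_bigr => p _; rewrite zero_extension_val.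
by move=> y /zero_extension_out ->; rewrite Normc.normc0 expr0n.
Qed.
End Norms.

(** * The sharp inequality and its maximizers *)

Section RuledSphereRestriction.
Variables (R : realType) (F : finFieldType) (chi : F -> R[i]).
Hypothesis chi_char : nonprincipal_additive_character chi.
Variables (S : {set 'rV[F]_3}) (L : option F -> 'rV[F]_3 -> F).
Hypothesis rS : ruled_sphere S L.
Local Notation q := (#|F|%:R : R).
Implicit Types f : points S -> R[i].

Let N_neq0 : #|S|%:R != 0 :> R.
Proof. by rewrite pnatr_eq0 -lt0n (card_ruled_sphere_gt0 rS). Qed.

Let q_neq0 : q != 0.
Proof. by rewrite pnatr_eq0 -lt0n ltnW // card_finNzRing_gt1. Qed.

Definition sharp_constant : R :=
  q ^+ 3 / #|S|%:R ^+ 2 * (q + 1 - 3 * q / #|S|%:R).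

Lemma sharp_constantE :
  sharp_constant = q ^+ 3 / #|S|%:R ^+ 2 * (q + 1 - 3 / (q - 1)).
Proof.
rewrite /sharp_constant; congr (_ * (_ - _)).
have -> : #|S|%:R = q * (q - 1).
  by rewrite (card_ruled_sphere rS) natrM -subn1 natrB // ltnW // card_finNzRing_gt1.
have q1 : q - 1 != 0 by rewrite subr_eq0 pnatr_eq1 neq_ltn card_finNzRing_gt1 orbT.
by field; rewrite q_neq0 q1.
Qed.

(** By the triangle inequality the energy can only grow when [f] is replaced by its modulus, to
    which [energy_le] applies, deficit included. *)
Lemma extension_stability f (a := fun x => modulus (zero_extension f x)) :
  L4norm (extension chi f) ^+ 4 + q ^+ 3 / #|S|%:R ^+ 4 *
    (\sum_x odd_sq a x ^+ 2 +
     q * \sum_(x in S) (even_sq a x - (\sum_x a x ^+ 2) / #|S|%:R) ^+ 2)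
  <= sharp_constant * L2norm f ^+ 4.
Proof.
have a_out x : x \notin S -> a x = 0.
  by move=> xS; rewrite /a zero_extension_out ?Normc.normc0.
have := energy_le rS a_out (fun x => modulus_ge0 _).
set D := _ + q * _; set W := \sum_x a x ^+ 2 => e.
rewrite (L4norm_extension chi_char) -mulrDr L2norm_zero_extension sharp_constantE -/W.
have -> : q ^+ 3 / #|S|%:R ^+ 2 * (q + 1 - 3 / (q - 1)) * (W ^+ 2 / #|S|%:R ^+ 2) =
    q ^+ 3 / #|S|%:R ^+ 4 * ((q + 1 - 3 / (q - 1)) * W ^+ 2).
  by set C := q + 1 - _; field.
rewrite ler_wpM2l ?divr_ge0 ?exprn_ge0 ?ler0n //; apply: le_trans e; rewrite lerD2r.
apply: ler_sum => s _; rewrite ler_sqr ?nnegrE ?modulus_ge0 //; last first.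
  by apply: sumr_ge0 => x _; rewrite mulr_ge0 ?modulus_ge0.
apply: le_trans (modulus_sum _) _.
by apply: ler_sum => x _; rewrite Normc.normcM.
Qed.

(** The zero extension is [c] times the indicator of [S], so equality comes from [sum_sqr_reps]. *)
Lemma extension_const f c : (forall p, f p = c) ->
  L4norm (extension chi f) ^+ 4 = sharp_constant * L2norm f ^+ 4 /\
  L2norm f ^+ 4 = modulus c ^+ 4.
Proof.
move=> fc; have fE x : zero_extension f x = c * (x \in S)%:R.
  rewrite /zero_extension; case: insubP => [p xS _|/negPf ->]; last by rewrite mulr0.
  by rewrite fc xS mulr1.
have L2 : L2norm f ^+ 4 = modulus c ^+ 4.
  rewrite L2norm_zero_extension.
  have -> : \sum_x modulus (zero_extension f x) ^+ 2 = modulus c ^+ 2 * #|S|%:R.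
    rewrite -sum1_card natr_sum [in RHS]big_mkcond mulr_sumr; apply: eq_bigr => x _.
    by rewrite fE Normc.normcM modulus_nat exprMn; case: (x \in S); rewrite ?expr1n ?expr0n.
  by rewrite exprMn mulfK ?expf_neq0 // -exprM.
split=> //; rewrite (L4norm_extension chi_char) L2 sharp_constantE.
have -> : \sum_s modulus (\sum_x zero_extension f x * zero_extension f (s - x)) ^+ 2 =
    modulus c ^+ 4 * ((q + 1 - 3 / (q - 1)) * #|S|%:R ^+ 2).
  rewrite -(sum_sqr_reps R rS) mulr_sumr; apply: eq_bigr => s _.
  have -> : \sum_x zero_extension f x * zero_extension f (s - x) = c ^+ 2 * (reps S s)%:R.
    rewrite /reps -sum1_card natr_sum [in RHS]big_mkcond mulr_sumr; apply: eq_bigr => x _.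
    by rewrite !fE inE mulrACA -expr2 -natrM mulnb; case: (_ && _).
  by rewrite Normc.normcM modulus_nat modulusX exprMn -exprM.
by set C := q + 1 - _; field.
Qed.

Lemma deficit_ge0 (a : 'rV[F]_3 -> R) (m : R) :
  0 <= \sum_x odd_sq a x ^+ 2 + q * \sum_(x in S) (even_sq a x - m) ^+ 2.
Proof.
rewrite addr_ge0 ?mulr_ge0 ?ler0n //; apply: sumr_ge0 => x _; exact: sqr_ge0.
Qed.

(** Both sums of squares vanish, so on [S] the odd part of [a ^+ 2] is 0 and the even part is
    [m]. *)
Lemma deficit_eq0 (a : 'rV[F]_3 -> R) (m : R) :
  \sum_x odd_sq a x ^+ 2 + q * \sum_(x in S) (even_sq a x - m) ^+ 2 <= 0 ->
  {in S, forall x, a x ^+ 2 = m}.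
Proof.
move=> D0 x xS; have o0 : 0 <= \sum_x odd_sq a x ^+ 2.
  by apply: sumr_ge0 => y _; exact: sqr_ge0.
have e0 : 0 <= \sum_(x in S) (even_sq a x - m) ^+ 2.
  by apply: sumr_ge0 => y _; exact: sqr_ge0.
have qe0 : 0 <= q * \sum_(x in S) (even_sq a x - m) ^+ 2 by rewrite mulr_ge0 ?ler0n.
have /eqP : \sum_x odd_sq a x ^+ 2 = 0 by lra.
rewrite psumr_eq0 => [/allP/(_ x (mem_index_enum x))|y _]; last exact: sqr_ge0.
rewrite /= sqrf_eq0 => /eqP ox.
have /eqP : q * \sum_(x in S) (even_sq a x - m) ^+ 2 = 0 by lra.
rewrite mulf_eq0 (negPf q_neq0) /= psumr_eq0 => [/allP/(_ x (mem_index_enum x))|y _]; last first.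
  exact: sqr_ge0.
rewrite xS /= sqrf_eq0 subr_eq0 => /eqP ex.
by rewrite -ex; move: ox; rewrite /odd_sq /even_sq; lra.
Qed.

Lemma extension_le f : L4norm (extension chi f) ^+ 4 <= sharp_constant * L2norm f ^+ 4.
Proof.
apply: le_trans (extension_stability f); rewrite lerDl mulr_ge0 ?deficit_ge0 //.
by rewrite divr_ge0 ?exprn_ge0 ?ler0n.
Qed.

Lemma maximizer_modulus f :
  L4norm (extension chi f) ^+ 4 = sharp_constant * L2norm f ^+ 4 ->
  exists r, forall p, modulus (f p) = r.
Proof.
move=> fmax; have /= := extension_stability f.
(* Equality leaves no room for the deficit, whose coefficient is positive. *)
rewrite fmax gerDl pmulr_rle0; last first.
  by rewrite divr_gt0 ?exprn_gt0 ?lt0r ?q_neq0 ?N_neq0 ?ler0n.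
set m := _ / #|S|%:R => /deficit_eq0 sqE; exists (Num.sqrt m) => p.
rewrite -(sqE (val p) (valP p)) sqrtr_sqr zero_extension_val ger0_norm //.
exact: modulus_ge0.
Qed.
End RuledSphereRestriction.

Theorem corollary1p3 (R : realType) (F : finFieldType) (q : nat)
    (Fq : #|F| = q) (p : nat) (charF : p \in [pchar F]) (odd_p : odd p)
    (chi : F -> R[i]) (chi_char : nonprincipal_additive_character chi)
    (j : F) (Nj_neq0 : - j != 0)
    (Nj_nonsquare : ~ (exists2 y : F, y != 0 & - j = y ^+ 2)) :
  let S := sphere j in
  let K : R := q%:R ^+ 3 / #|S|%:R ^+ 2 * (q%:R + 1 - 3 * q%:R / #|S|%:R) in
  [/\ forall f : points S -> R[i],
        L4norm (extension chi f) ^+ 4 <= K * L2norm f ^+ 4,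
      forall K' : R,
        (forall f : points S -> R[i],
           L4norm (extension chi f) ^+ 4 <= K' * L2norm f ^+ 4) -> K <= K',
      forall f : points S -> R[i], (exists c : R[i], forall xi, f xi = c) ->
        L4norm (extension chi f) ^+ 4 = K * L2norm f ^+ 4
    & forall f : points S -> R[i], (exists xi, f xi != 0) ->
        L4norm (extension chi f) ^+ 4 = K * L2norm f ^+ 4 ->
        exists r : R, forall xi, modulus (f xi) = r].
Proof.
have two_neq0 : 2 != 0 :> F.
  apply: contraL odd_p => /eqP/eqP; rewrite -(dvdn_pcharf charF).
  by rewrite dvdn_prime2 ?(pcharf_prime charF) // => /eqP->.
(* The root 0, which [Nj_nonsquare] does not exclude, is ruled out by [Nj_neq0]. *)
have nonsq (y : F) : y ^+ 2 != - j.
  apply/eqP => yj; apply: Nj_nonsquare; exists y => //.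
  by apply: contraNneq Nj_neq0 => y0; rewrite -yj y0 expr0n.
have [L rS] := ruled_sphere_nonsquare two_neq0 nonsq.
subst q; move=> S K; split.
- exact: (extension_le chi_char rS).
(* The constant function 1 has L2 norm 1, so testing on it gives [K <= K']. *)
- move=> K' /(_ (fun _ => 1)).
  have [-> ->] := extension_const chi_char rS (fun _ => erefl (1 : R[i])).
  by rewrite Normc.normc1 expr1n !mulr1.
- by move=> f [c fc]; have [] := extension_const chi_char rS fc.
- by move=> f _; apply: (maximizer_modulus chi_char rS).
Qed.
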